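(* Let $\Omega$ be a topological signature, let $A$ be a compact topological $\Omega$-algebra and let $L\subseteq A$. The following conditions are equivalent: (1) $\sigma_L$ is clopen (as a subset of $A\times A$); (2) $L$ is clopen and $\sigma_L$ is compactly determined; (3) $L$ is clopen and $\sigma_L$ is finitely determined; (4) $L$ is clopen and $\sigma_L$ is determined by a finite set of terms; (5) the quotient algebra $A/\sigma_L$ (with the quotient topology) is finite and discrete.
   Context: A topological signature is a sequence $\Omega=(\Omega_n)_{n\in\mathbb{N}}$ (with $0\in\mathbb{N}$) of topological spaces. An $\Omega$-algebra is a set $A$ with evaluation maps $E_n^A:\Omega_n\times A^n\to A$ ($n\in\mathbb{N}$); for $w\in\Omega_n$ write $w_A(a_1,\ldots,a_n)=E_n^A(w,a_1,\ldots,a_n)$. It is a topological $\Omega$-algebra if $A$ is a topological space and every $E_n^A$ is continuous. Compact spaces are required to be Hausdorff; a compact algebra is a topological algebra whose underlying space is compact. Let $T_\Omega(X)$ be the algebra of $\Omega$-terms over the set of variables $X$. A term is linear in a variable $x$ if $x$ occurs in it exactly once. The translation monoid $M(A)$ is the set of all maps $A\to A$ of the form $a\mapsto t_A(a_1,\ldots,a_{i-1},a,a_{i+1},\ldots,a_m)$, where $t\in T_\Omega(\{x_1,\ldots,x_m\})$ is linear in $x_i$ and $a_j\in A$ ($j\ne i$). The syntactic congruence $\sigma_L$ of $L\subseteq A$ is $\{(a,a')\in A\times A:\forall f\in M(A)\ (f(a)\in L\iff f(a')\in L)\}$; it is the largest congruence on $A$ for which $L$ is a union of classes. $\mathcal{C}(A)$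 is the set of continuous maps $A\to A$ with the compact-open topology. For a set $S$ of functions $A\to A$, $\sigma_L$ is $S$-determined if for all $a,a'\in A$: $(a,a')\in\sigma_L$ if and only if $\forall f\in S\ (f(a)\in L\iff f(a')\in L)$. $\sigma_L$ is compactly determined if it is $C$-determined for some compact subset $C$ of $\mathcal{C}(A)$, and finitely determined if it is $F$-determined for some finite subset $F$ of $\mathcal{C}(A)$. $\sigma_L$ is determined by a finite set of terms if there are $m\geq 1$ and a finite subset $F$ of $T_\Omega(\{x_1,\ldots,x_m\})$ such that $\sigma_L$ consists of all pairs $(a,a')\in A^2$ for which $\forall t\in F\ \forall b_2,\ldots,b_m\in A\ (t_A(a,b_2,\ldots,b_m)\in L\iff t_A(a',b_2,\ldots,b_m)\in L)$. *)

(* Defs.v *)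
From HB Require Import structures.
From mathcomp Require Import all_boot all_order.
From mathcomp Require Import generic_quotient.
From mathcomp Require Import mathcomp_extra boolp classical_sets functions.
From mathcomp Require Import cardinality topology.

Set Implicit Arguments.
Unset Strict Implicit.
Unset Printing Implicit Defensive.

Local Open Scope classical_set_scope.

Definition top_signature := nat -> topologicalType.

Section Algebras.
Variable Omega : top_signature.

(* [{ptws 'I_n -> A}] is the power A^n; its product topology is the one used
   by [topological_algebra]. *)
Definition algebra (A : Type) : Type :=
  forall n : nat, Omega n * {ptws 'I_n -> A} -> A.

Definition topological_algebra (A : topologicalType) (E : algebra A) : Prop :=
  forall n : nat, continuous (E n).

(* Compact spaces are Hausdorff by convention. *)
Definition compact_algebra (A : topologicalType) (E : algebra A) : Prop :=
  [/\ topological_algebra E, compact [set: A] & hausdorff_space A].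

Inductive term (X : Type) : Type :=
  | Var of X
  | App n of Omega n & ('I_n -> term X).

Fixpoint eval_term (A : Type) (E : algebra A) (X : Type) (v : X -> A)
    (t : term X) : A :=
  match t with
  | Var x => v x
  | App n w ts => E n (w, fun i => eval_term E v (ts i))
  end.

Fixpoint occurrences (X : eqType) (x : X) (t : term X) : nat :=
  match t with
  | Var y => (y == x)
  | App n w ts => (\sum_(i < n) occurrences x (ts i))%N
  end.

Definition linear_in (X : eqType) (x : X) (t : term X) : Prop :=
  occurrences x t = 1%N.

End Algebras.

Arguments Var {Omega X}.
Arguments App {Omega X n}.

(* The tuple with [x] at position [i] and the entries of [b], in order, at the
   remaining positions. *)
Definition insert_at (A : Type) (m : nat) (i : 'I_m.+1) (b : 'I_m -> A) (x : A)
    : 'I_m.+1 -> A :=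
  fun j => oapp b x (unlift i j).

Section SyntacticCongruence.
Variables (Omega : top_signature).

(* The number of variables is at least 1 since one of them is singled out. *)
Definition translations (A : Type) (E : algebra Omega A) : set (A -> A) :=
  [set f | exists (m : nat) (t : term Omega 'I_m.+1) (i : 'I_m.+1)
             (b : 'I_m -> A),
     linear_in i t /\ f = fun x => eval_term E (insert_at i b x) t].

Definition syntactic_congruence (A : Type) (E : algebra Omega A) (L : set A)
    : set (A * A) :=
  [set p | forall f, translations E f -> (L (f p.1) <-> L (f p.2))].

Definition determined_by (A : Type) (E : algebra Omega A) (L : set A)
    (S : set (A -> A)) : Prop :=
  forall a a' : A, syntactic_congruence E L (a, a') <->
    forall f, S f -> (L (f a) <-> L (f a')).

Definition determined_by_terms (A : Type) (E : algebra Omega A) (L : set A)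
    : Prop :=
  exists (m : nat) (F : set (term Omega 'I_m.+1)), finite_set F /\
    forall a a' : A, syntactic_congruence E L (a, a') <->
      forall t, F t -> forall b : 'I_m -> A,
        (L (eval_term E (insert_at ord0 b a) t) <->
         L (eval_term E (insert_at ord0 b a') t)).

Section CompactOpen.
(* Equips [continuousType A A] with the compact-open topology. *)
Import ArrowAsCompactOpen.

Definition compactly_determined (A : topologicalType) (E : algebra Omega A)
    (L : set A) : Prop :=
  exists C : set (continuousType A A), compact C /\
    determined_by E L ((fun f : continuousType A A => f : A -> A) @` C).

Definition finitely_determined (A : topologicalType) (E : algebra Omega A)
    (L : set A) : Prop :=
  exists F : set (continuousType A A), finite_set F /\
    determined_by E L ((fun f : continuousType A A => f : A -> A) @` F).

End CompactOpen.

Section Congruence.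
Variables (A : Type) (E : algebra Omega A).
Arguments E : clear implicits.

Fixpoint subst_term (X Y : Type) (s : X -> term Omega Y) (t : term Omega X)
    : term Omega Y :=
  match t with
  | Var x => s x
  | App n w ts => App w (fun i => subst_term s (ts i))
  end.

Lemma eval_subst (X Y : Type) (s : X -> term Omega Y) (v : Y -> A) t :
  eval_term E v (subst_term s t) = eval_term E (fun x => eval_term E v (s x)) t.
Proof.
elim: t => [//|n w ts IH] /=.
by congr (E n (w, _)); apply: functional_extensionality_dep => i; exact: IH.
Qed.

Lemma occurrences_subst (X Y : eqType) (s : X -> term Omega Y) x y t :
  (forall z, occurrences y (s z) = (z == x)) ->
  occurrences y (subst_term s t) = occurrences x t.
Proof.
move=> sP; elim: t => [z|n w ts IH] /=; first exact: sP.
by apply: eq_bigr => i _; exact: IH.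
Qed.

Lemma translations_comp_op n (w : Omega n) (k : 'I_n) (c : 'I_n -> A) f :
  translations E f ->
  translations E (fun x => f (E n (w, fun j => if j == k then x else c j))).
Proof.
case=> m [t [i [b [tlin ->]]]].
pose s (j : 'I_m.+1) : term Omega 'I_(m + n).+1 :=
  match unlift i j with
  | Some j' => Var (lift ord0 (lshift n j'))
  | None => App w (fun l => if l == k then Var ord0
                            else Var (lift ord0 (rshift m l)))
  end.
pose b' (l : 'I_(m + n)) : A :=
  match fintype.split l with inl j => b j | inr l' => c l' end.
exists (m + n)%N, (subst_term s t), ord0, b'; split.
  rewrite /linear_in -tlin; apply: occurrences_subst => z; rewrite /s.
  case: unliftP => [j ->|->] /=.
    by rewrite (eq_sym (lift i j)) (negbTE (neq_lift _ _)).
  by rewrite !eqxx (bigD1 k) //= eqxx /= big1 // => l /negbTE ->.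
apply: functional_extensionality_dep => x; rewrite eval_subst; congr eval_term.
apply: functional_extensionality_dep => j; rewrite /s {1}/insert_at.
case: unlift => [j'|] /=.
  by rewrite /insert_at liftK /= /b' (unsplitK (inl j')).
congr (E n (w, _)); apply: functional_extensionality_dep => l.
case: eqP => _ /=; first by rewrite /insert_at unlift_none.
by rewrite /insert_at liftK /= /b' (unsplitK (inr l)).
Qed.

Lemma syntactic_congruence_op (L : set A) n (w : Omega n) (a a' : 'I_n -> A) :
  (forall i, syntactic_congruence E L (a i, a' i)) ->
  syntactic_congruence E L (E n (w, a), E n (w, a')).
Proof.
move=> aa' f Ef /=; pose c k (j : 'I_n) := if (j < k)%N then a' j else a j.
suff H k : (k <= n)%N -> L (f (E n (w, a))) <-> L (f (E n (w, c k))).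
  have -> : a' = c n.
    by apply: functional_extensionality_dep => j; rewrite /c ltn_ord.
  exact: H.
elim: k => [_|k IH kn].
  by have -> : c 0%N = a by apply: functional_extensionality_dep.
apply: iff_trans (IH (ltnW kn)) _; pose o := Ordinal kn.
have := aa' o _ (translations_comp_op w o (c k) Ef); rewrite /=.
have -> : (fun j => if j == o then a o else c k j) = c k.
  apply: functional_extensionality_dep => j.
  by case: eqP => [->|//]; rewrite /c ltnn.
have -> // : (fun j => if j == o then a' o else c k j) = c k.+1.
apply: functional_extensionality_dep => j.
rewrite /c ltnS [(j <= k)%N]leq_eqVlt -(inj_eq val_inj) /=.
by case: eqP => [jk|//] /=; congr a'; apply: val_inj.
Qed.

End Congruence.

Section Quotient.
Local Open Scope quotient_scope.
Variables (A : topologicalType) (E : algebra Omega A) (L : set A).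
Arguments E : clear implicits.

Definition syntactic_rel : rel A :=
  fun a a' => `[< syntactic_congruence E L (a, a') >].

Lemma syntactic_rel_refl : reflexive syntactic_rel.
Proof. by move=> a; apply/asboolP => f _. Qed.

Lemma syntactic_rel_sym : symmetric syntactic_rel.
Proof. by move=> a b; apply/asboolP/asboolP => + f Ef => /(_ f Ef) []. Qed.

Lemma syntactic_rel_trans : transitive syntactic_rel.
Proof.
move=> b a c /asboolP ab /asboolP bc; apply/asboolP => f Ef.
exact: iff_trans (ab f Ef) (bc f Ef).
Qed.

Canonical syntactic_equiv :=
  EquivRel syntactic_rel syntactic_rel_refl syntactic_rel_sym
    syntactic_rel_trans.

Definition syntactic_quotient : topologicalType :=
  quotient_topology {eq_quot syntactic_equiv}.

Definition syntactic_pi (a : A) : syntactic_quotient :=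
  \pi_{eq_quot syntactic_equiv} a.

(* The operations of the quotient algebra, well defined by
   [quotient_algebra_pi]. *)
Definition quotient_algebra : algebra Omega syntactic_quotient :=
  fun n p => syntactic_pi
    (E n (p.1, fun i => repr (p.2 i : {eq_quot syntactic_equiv}))).

Lemma quotient_algebra_pi n (w : Omega n) (a : 'I_n -> A) :
  @quotient_algebra n (w, fun i => syntactic_pi (a i)) =
  syntactic_pi (E n (w, a)).
Proof.
apply/eqmodP/asboolP; apply: syntactic_congruence_op => i.
by apply/asboolP; rewrite -/(syntactic_rel _ _); apply/eqmodP; exact: reprK.
Qed.

End Quotient.
End SyntacticCongruence.

Definition discrete_space (T : topologicalType) : Prop :=
  forall U : set T, open U.

(* Main.v *)
Require Import Defs.
From mathcomp Require Import all_boot all_order.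
From mathcomp Require Import mathcomp_extra boolp classical_sets functions.
From mathcomp Require Import cardinality topology.
From mathcomp Require Import generic_quotient.

(** Everything is compared with the first condition.  An equivalence relation
is clopen exactly when each point has a neighbourhood inside its own class
([clopen_equivP]), so to be clopen is a local condition on the syntactic
congruence.

Suppose that the congruence is clopen.  The language [L] is clopen because
the identity is a translation.  The classes are open, hence the quotient is
discrete, and compactness leaves only finitely many of them.  Choose one
translation separating each pair of inequivalent class representatives: as
membership of [f a] in [L] depends only on the class of [a] when [f] is a
translation, these finitely many translations already determine the
congruence ([clopen_sigma_translations]).  They are continuous, which gives
finite and therefore compact determination, and they can all be written with
terms in one common set of variables, linear in the first
([translation_term]); freeing the parameters of these terms only adds further
translations, which gives determination by finitely many terms.

Conversely, suppose that [L] is clopen and that the congruence is the kernel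
of a family of tests depending on a parameter [z] in a compact space: a
continuous map [z] tested at [a] for the compact-open topology, or a term
with parameter tuple [z] in the compact power of [A].  In both cases the
outcome of the test is locally constant in [z] and [a] jointly, and by
compactness (tube lemma, [compact_kernel_near]) one neighbourhood of [a]
serves for all [z] at once.  So each point has a neighbourhood in its class.
For a discrete quotient this is immediate, classes being preimages of
points. *)

Local Open Scope classical_set_scope.

(** * Clopen sets and compact families of tests *)

Lemma near_finite_set {I T : Type} {F : set_system T} {FF : Filter F}
    {D : set I} {P : I -> T -> Prop} :
  finite_set D -> (forall i, D i -> \forall x \near F, P i x) ->
  \forall x \near F, forall i, D i -> P i x.
Proof.
move=> /(@finite_fsetP {classic I})[S ->] FP.
by have := @filter_bigI T {classic I} S P F FF FP.
Qed.

Lemma near_iff {T : topologicalType} {U : set T} (x : T) :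
  clopen U -> \forall y \near x, U x <-> U y.
Proof.
move=> [oU cU]; have [Ux|nUx] := pselect (U x).
  by apply: (@filterS _ _ _ U); [move=> y|exact: open_nbhs_nbhs].
apply: (@filterS _ _ _ (~` U)); first by move=> y.
by apply: open_nbhs_nbhs; split=> //; exact: closed_openC.
Qed.

Lemma clopen_near {T : topologicalType} {U : set T} :
  (forall x, \forall y \near x, U x <-> U y) -> clopen U.
Proof.
move=> Unear; split; last rewrite -openC.
  by rewrite openE => x Ux; apply: filterS (Unear x) => y [/(_ Ux)].
by rewrite openE => x nUx; apply: filterS (Unear x) => y [_ +] Uy => /(_ Uy).
Qed.

(** If classes are neighbourhoods of their points then products of classes are
neighbourhoods of theirs, and such a product lies either inside the relation
or outside it. *)
Lemma clopen_equivP {T : topologicalType} (R : set (T * T)) :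
  (forall x, R (x, x)) -> (forall x y, R (x, y) -> R (y, x)) ->
  (forall x y z, R (x, y) -> R (y, z) -> R (x, z)) ->
  clopen R <-> forall x, \forall y \near x, R (x, y).
Proof.
move=> refl sym trans; split=> [[oR _] x|Rnear].
  have : nbhs (x, x) R by apply: open_nbhs_nbhs.
  case=> -[U V] /= [Ux Vx] sR; apply: filterS Vx => y Vy.
  by apply: (sR (x, y)); split=> //; exact: nbhs_singleton Ux.
apply: clopen_near => -[x y].
have Rxy : \forall p \near (x, y), R (x, p.1) /\ R (y, p.2).
  exists (fun x' => R (x, x'), fun y' => R (y, y')) => //=.
  by split; exact: Rnear.
apply: filterS Rxy => -[x' y'] /= [xx' yy']; split=> ?.
  by apply: (trans _ x); [exact: sym|apply: (trans _ y)].
by apply: (trans _ x') => //; apply: (trans _ y'); last exact: sym.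
Qed.

(** A tube lemma: a neighbourhood of [x] works for all [z'] near a given
[z], and compactness of [K] reduces the choice of [z] to finitely many. *)
Lemma compact_kernel_near {Z T : topologicalType} {K : set Z}
    {P : Z -> T -> Prop} (x : T) : compact K ->
  (forall z, K z -> \forall z' \near z & y \near x, P z x <-> P z' y) ->
  \forall y \near x, forall z, K z -> (P z x <-> P z y).
Proof.
move=> /compact_near_coveringP Kcov Pxy.
apply: (Kcov _ (nbhs x) (fun y z => P z x <-> P z y)) => z Kz.
case: (Pxy z Kz) => -[U V] /= [Uz Vx] sP.
exists (U, V) => //= -[z' y] /= [Uz' Vy].
(* Compare both [P z' x] and [P z' y] with [P z x]. *)
have := sP (z', y) (conj Uz' Vy).
have := sP (z', x) (conj Uz' (nbhs_singleton Vx)).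
by move=> /= <-.
Qed.

(** * Continuity of term functions *)

Lemma continuous_ptws {T V : topologicalType} {I : Type}
    (f : T -> {ptws I -> V}) :
  (forall i, continuous (f ^~ i)) -> continuous f.
Proof.
move=> fi x; apply/cvg_sup => i.
apply/cvg_image; first by rewrite eqEsubset; split=> v // _; exists (fun=> v).
move=> W Wfx; exists ((@^~ i) @^-1` W); first exact: fi.
by rewrite image_preimage // eqEsubset; split=> // v _; exists (fun=> v).
Qed.

Lemma insert_at_continuous {A : topologicalType} {m : nat} (i : 'I_m.+1) :
  continuous (fun p : {ptws 'I_m -> A} * A =>
    insert_at i p.1 p.2 : {ptws 'I_m.+1 -> A}).
Proof.
apply: continuous_ptws => j; rewrite /insert_at.
case: unliftP => [k _|_] /=; last by move=> p; exact: cvg_snd.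
move=> p; have fst_p : {for p, continuous (@fst {ptws 'I_m -> A} A)}.
  exact: cvg_fst.
exact: (continuous_comp fst_p (@proj_continuous 'I_m (fun=> A) k p.1)).
Qed.

Section Algebra.
Context {Omega : top_signature} {A : topologicalType}.
Context {E : algebra Omega A} {L : set A}.

Local Notation sigma := (syntactic_congruence E L).

Lemma eval_term_continuous {X : eqType} (t : term Omega X) :
  topological_algebra E ->
  continuous (fun v : {ptws X -> A} => eval_term E v t).
Proof.
move=> Ects; elim: t => [x|n w ts IH] /=; first exact: proj_continuous.
have argc : continuous (fun v : {ptws X -> A} =>
    (w, (fun i => eval_term E v (ts i)) : {ptws 'I_n -> A})).
  have tsc := @continuous_ptws {ptws X -> A} A _
    (fun v i => eval_term E v (ts i)) IH.
  by move=> v; exact: (cvg_pair (cvg_cst w) (tsc v)).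
by move=> v; exact: (continuous_comp (argc v) (Ects n _)).
Qed.

(** Continuity is needed in the parameters as well as in the argument, since
the parameter tuples are the points of the compact space over which
[compact_kernel_near] is applied. *)
Lemma eval_insert_continuous {m} (i : 'I_m.+1) (t : term Omega 'I_m.+1) :
  topological_algebra E ->
  continuous (fun p : {ptws 'I_m -> A} * A =>
    eval_term E (insert_at i p.1 p.2) t).
Proof.
move=> Ects p.
exact: (continuous_comp (insert_at_continuous i p)
  (eval_term_continuous t Ects _)).
Qed.

Lemma translation_continuous {f} :
  topological_algebra E -> translations E f -> continuous f.
Proof.
move=> Ects [m [t [i [b [_ ->]]]]] x.
have pairc : {for x, continuous (fun x : A => (b : {ptws 'I_m -> A}, x))}.
  exact: (cvg_pair (cvg_cst _) cvg_id).
exact: (continuous_comp pairc (eval_insert_continuous i t Ects _)).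
Qed.

(** * Clopen syntactic congruences *)

Lemma translation_id : translations E id.
Proof.
exists 0%N, (Var ord0), ord0, (fun j : 'I_0 => False_rect _ (notF (ltn_ord j))).
split=> //; apply/funext => x /=.
by rewrite /insert_at unlift_none.
Qed.

Lemma sigma_sym {a a'} : sigma (a, a') -> sigma (a', a).
Proof. by move=> aa' f /aa' []. Qed.

Lemma sigma_trans {a b c} : sigma (a, b) -> sigma (b, c) -> sigma (a, c).
Proof. by move=> ab bc f Ef; exact: iff_trans (ab f Ef) (bc f Ef). Qed.

Lemma clopen_sigmaP :
  clopen sigma <-> forall a, \forall a' \near a, sigma (a, a').
Proof.
apply: clopen_equivP => [a f //|a a'|a b c].
  exact: sigma_sym.
exact: sigma_trans.
Qed.

Lemma clopen_sigma_language : clopen sigma -> clopen L.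
Proof.
move=> /clopen_sigmaP sig; apply: clopen_near => a.
by apply: filterS (sig a) => a' /(_ id translation_id).
Qed.

Lemma clopen_sigma_finite_index : compact [set: A] -> clopen sigma ->
  exists S : set A, finite_set S /\ forall a, exists2 r, S r & sigma (a, r).
Proof.
move=> Acpt /clopen_sigmaP sig.
(* Compactness is used as near covering, along the filter of sets that contain
   a given finite set: near each point, the sets that contain this point
   represent all nearby classes. *)
pose Fin : set_system (set A) :=
  filter_from finite_set (fun S => [set S' | S `<=` S']).
have FinF : Filter Fin.
  apply: filter_from_filter; first by exists set0; exact: finite_set0.
  move=> S S' Sfin S'fin; exists (S `|` S'); first by rewrite finite_setU.
  by move=> S'' /=; rewrite subUset.
have [S Sfin SP] :
    Fin [set S | [set: A] `<=` [set a | exists2 r, S r & sigma (a, r)]].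
  have Acov := (compact_near_coveringP _).1 Acpt.
  apply: (Acov _ Fin (fun S a => exists2 r, S r & sigma (a, r))) => x _.
  exists ([set a | sigma (a, x)], [set S | S x]) => /=.
    split; first by apply: filterS (sig x) => a; exact: sigma_sym.
    by exists [set x]; [exact: finite_set1|move=> S; exact].
  by move=> [a S] /= [ax Sx]; exists x.
by exists S; split=> // a; exact: (SP S).
Qed.

(** One translation for each pair of representatives of the finitely many
classes is enough: for a translation [f], membership of [f a] in [L] can be
tested on the representative of the class of [a]. *)
Lemma clopen_sigma_translations : compact [set: A] -> clopen sigma ->
  exists F : set (A -> A),
    [/\ finite_set F, F `<=` translations E & determined_by E L F].
Proof.
move=> Acpt /(clopen_sigma_finite_index Acpt)[S [Sfin Srep]].
(* For equivalent pairs the choice does not matter; the identity is taken. *)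
have sepP (p : A * A) : exists f, translations E f /\
    ((L (f p.1) <-> L (f p.2)) -> sigma p).
  have [sp|/existsNP[f /not_implyP[Ef nf]]] := pselect (sigma p).
    by exists id; split=> //; exact: translation_id.
  by exists f.
have [sep sepE] := choice sepP.
exists (sep @` (S `*` S)); split.
- by apply: finite_image; exact: finite_setX.
- by move=> _ [p _ <-]; exact: (sepE p).1.
move=> a a'; split=> [aa' _ [p _ <-]|H]; first exact/aa'/(sepE p).1.
have [[r Sr ar] [r' Sr' ar']] := (Srep a, Srep a').
apply: (sigma_trans ar); apply: sigma_trans (sigma_sym ar').
have [Ef] := sepE (r, r'); apply => /=.
have Hf : L (sep (r, r') a) <-> L (sep (r, r') a').
  by apply: H; exists (r, r').
have /= ra := ar _ Ef; have /= ra' := ar' _ Ef.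
exact: iff_trans (iff_trans (iff_sym ra) Hf) ra'.
Qed.

(** The variables of a term representing [f] can be renamed so that the
distinguished one comes first, and then padded with dummy variables.  Any
large enough number of variables can thus be used, which allows finitely many
translations to share it.  The element [a0] gives the dummy variables a value;
it comes after the choice of the term so that the term itself does not depend
on it. *)
Lemma translation_term {f} : translations E f ->
  \forall m \near \oo, exists t : term Omega 'I_m.+1, linear_in ord0 t /\
    forall a0 : A, exists b, f = fun x => eval_term E (insert_at ord0 b x) t.
Proof.
case=> k [t [i [b [tlin ->]]]]; exists k => // m /= km.
pose s (j : 'I_k.+1) : term Omega 'I_m.+1 :=
  Var (oapp (fun j' => lift ord0 (widen_ord km j')) ord0 (unlift i j)).
exists (subst_term s t); split.
  rewrite /linear_in -tlin; apply: occurrences_subst => z; rewrite /s.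
  case: unliftP => [j ->|->] /=; last by rewrite !eqxx.
  by rewrite (eq_sym (lift i j)) (negbTE (neq_lift _ _)).
move=> a0; exists (fun l => oapp b a0 (insub (val l))).
apply/funext => x; rewrite eval_subst; congr eval_term.
apply/funext => j; rewrite /s {1}/insert_at /=.
case: unliftP => [j' _|_] /=; rewrite /insert_at; last by rewrite unlift_none.
by rewrite liftK /=; have /= -> := valK j'.
Qed.

(** A term linear in its first variable yields a translation for every value of
the other ones, so that quantifying over these values tests with nothing but
translations, among them those of [F]. *)
Lemma determined_by_translations_terms {F : set (A -> A)} :
  finite_set F -> F `<=` translations E -> determined_by E L F ->
  determined_by_terms E L.
Proof.
move=> Ffin FE Fdet.
have [m Fm] := filter_ex (near_finite_set Ffin
  (fun f Ff => translation_term (FE f Ff))).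
have tP f : exists t : term Omega 'I_m.+1, F f -> linear_in ord0 t /\
    forall a0 : A, exists b, f = fun x => eval_term E (insert_at ord0 b x) t.
  have [/Fm[t tE]|nFf] := pselect (F f); first by exists t.
  by exists (Var ord0).
have [t tE] := choice tP.
exists m, (t @` F); split; first exact: finite_image.
move=> a a'; split=> [aa' _ [f Ff <-] b|H].
  apply: (aa' (fun x => eval_term E (insert_at ord0 b x) (t f))).
  by exists m, (t f), ord0, b; split=> //; exact: (tE f Ff).1.
apply/Fdet => f Ff; have [_ /(_ a)[b {1 2}->]] := tE f Ff.
by apply: H; exists f.
Qed.

Lemma terms_clopen_sigma :
  topological_algebra E -> compact [set: A] -> clopen L ->
  determined_by_terms E L -> clopen sigma.
Proof.
move=> Ects Acpt Lclopen [m [F [Ffin Fdet]]]; apply/clopen_sigmaP => a.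
have Am : compact [set: {ptws 'I_m -> A}].
  have := @tychonoff 'I_m (fun=> A) (fun=> setT) (fun=> Acpt).
  by congr compact; rewrite eqEsubset; split.
have : \forall a' \near a, forall t, F t -> forall b : {ptws 'I_m -> A},
    setT b -> (L (eval_term E (insert_at ord0 b a) t) <->
               L (eval_term E (insert_at ord0 b a') t)).
  apply: near_finite_set => // t Ft.
  apply: compact_kernel_near => // b _.
  have := eval_insert_continuous ord0 t Ects (b, a) _ (near_iff _ Lclopen).
  exact.
by apply: filterS => a' H; apply/Fdet => t Ft b; exact: H.
Qed.

(** * The quotient *)

Local Open Scope quotient_scope.

Lemma syntactic_piP {a a' : A} :
  syntactic_pi E L a = syntactic_pi E L a' <-> sigma (a, a').
Proof. by split=> [/eqmodP/asboolP//|aa']; exact/eqmodP/asboolP. Qed.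

Lemma syntactic_pi_surj (q : syntactic_quotient E L) :
  exists a, q = syntactic_pi E L a.
Proof.
exists (repr (q : {eq_quot syntactic_equiv E L})).
by rewrite -[LHS](reprK (q : {eq_quot syntactic_equiv E L})).
Qed.

Lemma discrete_quotient_clopen :
  discrete_space (syntactic_quotient E L) -> clopen sigma.
Proof.
move=> disc; apply/clopen_sigmaP => a.
have : nbhs a (@syntactic_pi _ _ E L @^-1` [set syntactic_pi E L a]).
  by apply: open_nbhs_nbhs; split=> //; exact: disc.
by apply: filterS => a' /= /esym/syntactic_piP.
Qed.

Lemma clopen_discrete_quotient :
  clopen sigma -> discrete_space (syntactic_quotient E L).
Proof.
move=> /clopen_sigmaP sig U.
(* Openness in the quotient topology unfolds to openness of the preimage. *)
suff : open (@syntactic_pi _ _ E L @^-1` U) by [].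
rewrite openE => a Ua; apply: filterS (sig a) => a' /syntactic_piP aa' /=.
by rewrite -aa'.
Qed.

Lemma clopen_finite_quotient : compact [set: A] -> clopen sigma ->
  finite_set [set: syntactic_quotient E L].
Proof.
move=> Acpt sig; have [S [Sfin Srep]] := clopen_sigma_finite_index Acpt sig.
apply: sub_finite_set (finite_image (@syntactic_pi _ _ E L) Sfin) => q _.
have [a ->] := syntactic_pi_surj q; have [r Sr ar] := Srep a.
by exists r => //; exact/esym/syntactic_piP.
Qed.

(** * Determination by continuous maps *)

Section CompactOpen.
Import ArrowAsCompactOpen.

(** Whether [f a] lies in [L] is locally constant in the pair of [f] and [a]:
if [W] is the one of [L] and its complement that contains [f a], then the
preimage [V] of [W] by [f] is a clopen, hence compact, neighbourhood of [a],
and the maps sending [V] into [W] form a basic compact-open neighbourhood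
of [f]. *)
Lemma compactly_determined_clopen_sigma :
  compact [set: A] -> clopen L ->
  compactly_determined E L -> clopen sigma.
Proof.
move=> Acpt Lclopen [C [Ccpt Cdet]]; apply/clopen_sigmaP => a.
have : \forall a' \near a, forall f : continuousType A A, C f ->
    (L (f a) <-> L (f a')).
  apply: compact_kernel_near => // f _.
  pose W := [set y | L (f a) <-> L y].
  have Wclopen : clopen W.
    apply: clopen_near => y; have Ly := near_iff y Lclopen.
    apply: filterS Ly => y' Lyy'.
    by split=> Wy; [exact: iff_trans Wy Lyy'|exact: iff_trans Wy (iff_sym Lyy')].
  have [Vopen Vclosed] : clopen (f @^-1` W).
    by apply: preimage_clopen => //; exact: cts_fun.
  have Vcpt : compact (f @^-1` W) by exact: subclosed_compact Vclosed Acpt _.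
  pose N := [set g : {compact-open, A -> A} | g @` (f @^-1` W) `<=` W].
  have Nopen : open N := compact_open_open Vcpt Wclopen.1.
  exists ([set g : continuousType A A | N g], f @^-1` W).
    split; apply: open_nbhs_nbhs; split=> //=; first by exists N.
    exact: image_preimage_subset.
  by move=> [g y] /= [Ng Wfy]; apply: Ng; exists y.
by apply: filterS => a' H; apply/Cdet => _ [f Cf <-]; exact: H.
Qed.

Lemma translations_finitely_determined {F : set (A -> A)} :
  topological_algebra E ->
  finite_set F -> F `<=` translations E -> determined_by E L F ->
  finitely_determined E L.
Proof.
move=> Ects Ffin FE Fdet.
have cP f : exists g : continuousType A A, F f -> (g : A -> A) = f.
  have [Ff|nFf] := pselect (F f); last by exists idfun.
  by exists (mkcts (translation_continuous Ects (FE f Ff))).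
have [c cE] := choice cP.
exists (c @` F); split; first exact: finite_image.
suff -> : (fun f : continuousType A A => f : A -> A) @` (c @` F) = F by [].
rewrite eqEsubset; split=> [_ [_ [f Ff <-] <-]|f Ff]; first by rewrite cE.
by exists (c f); [exists f|exact: cE].
Qed.

Lemma finitely_compactly_determined :
  finitely_determined E L -> compactly_determined E L.
Proof. by case=> F [Ffin Fdet]; exists F; split=> //; exact: finite_compact. Qed.

End CompactOpen.
End Algebra.

Theorem theorem5p16 (Omega : top_signature) (A : topologicalType)
    (E : algebra Omega A) (hA : compact_algebra E) (L : set A) :
  [<-> clopen (syntactic_congruence E L);
       clopen L /\ compactly_determined E L;
       clopen L /\ finitely_determined E L;
       clopen L /\ determined_by_terms E L;
       finite_set [set: syntactic_quotient E L] /\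
         discrete_space (syntactic_quotient E L)].
Proof.
have [Ects Acpt _] := hA.
have fin : clopen (syntactic_congruence E L) ->
    clopen L /\ finitely_determined E L.
  move=> sig; have [F [Ffin FE Fdet]] := clopen_sigma_translations Acpt sig.
  split; first exact: clopen_sigma_language sig.
  exact: translations_finitely_determined Ffin FE Fdet.
have cpt_sig : clopen L /\ compactly_determined E L ->
    clopen (syntactic_congruence E L).
  by case=> Lclopen; exact: compactly_determined_clopen_sigma.
tfae.
- by move=> /fin[Lclopen /finitely_compactly_determined].
- by move=> /cpt_sig.
- move=> [Lclopen /finitely_compactly_determined Lcpt]; split=> //.
  have [F [Ffin FE Fdet]] :=
    clopen_sigma_translations Acpt (cpt_sig (conj Lclopen Lcpt)).
  exact: determined_by_translations_terms Ffin FE Fdet.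
- move=> [Lclopen Lterms]; have sig := terms_clopen_sigma Ects Acpt Lclopen Lterms.
  by split; [exact: clopen_finite_quotient|exact: clopen_discrete_quotient].
- by case=> _; exact: discrete_quotient_clopen.
Qed.
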